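(* Let $X$ be a locally compact Hausdorff space, let $A$ be a real normed algebra, and let $\pi\colon C_0(X)\to A$ be a continuous algebra homomorphism. Let $q\colon C_0(X)\to C_0(X)/\operatorname{Ker}\pi$ be the quotient map, and let $\overline\pi\colon C_0(X)/\operatorname{Ker}\pi\to A$ be the algebra homomorphism such that $\pi=\overline\pi\circ q$. Then $\|q(f)\|\le\|\overline\pi(q(f))\|\le\|\pi\|\,\|q(f)\|$ for $f\in C_0(X)$. Consequently, $\overline\pi$ is a topological embedding of $C_0(X)/\operatorname{Ker}\pi$ as the subalgebra $\pi(C_0(X))$ of $A$, where $\pi(C_0(X))$ is closed in $A$.
   Context: $C_0(X)$ is the algebra of real-valued continuous functions on $X$ that vanish at infinity, with the supremum norm; the quotient carries the quotient norm. Normed algebras are associative with a submultiplicative norm; $A$ is not required to be complete or unital, an identity element need not have norm 1, and algebra homomorphisms need not be unital. *)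

(* Defs.v *)
From HB Require Import structures.
From mathcomp Require Import all_boot all_order all_algebra.
From mathcomp Require Import all_classical all_reals all_analysis.

Set Implicit Arguments.
Unset Strict Implicit.
Unset Printing Implicit Defensive.

Import Order.TTheory GRing.Theory Num.Theory.
Import numFieldNormedType.Exports.

Local Open Scope classical_set_scope.
Local Open Scope quotient_scope.
Local Open Scope ring_scope.

Reserved Notation "x ** y" (at level 40, left associativity).
Reserved Notation "{ 'alghom' A '->' B }"
  (at level 0, A at level 98, B at level 99, format "{ 'alghom'  A  ->  B }").

(* No identity element and no completeness: MathComp's algebra structures are
   all unital, hence the separate multiplication amul. *)
HB.mixin Record NormedModule_isNormedAlgebra (R : numDomainType) A
    of NormedModule R A := {
  amul : A -> A -> A;
  amulA : associative amul;
  amulDl : left_distributive amul +%R;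
  amulDr : right_distributive amul +%R;
  amulZl : forall (k : R) (x y : A), amul (k *: x) y = k *: amul x y;
  amulZr : forall (k : R) (x y : A), amul x (k *: y) = k *: amul x y;
  normr_amul : forall x y : A, `|amul x y| <= `|x| * `|y|
}.

#[short(type="normedAlgType")]
HB.structure Definition NormedAlgebra (R : numDomainType) :=
  {A of NormedModule R A & NormedModule_isNormedAlgebra R A}.

Notation "x ** y" := (amul x y) : ring_scope.

HB.mixin Record isAlgMultiplicative (R : numDomainType)
    (A B : normedAlgType R) (f : A -> B) := {
  alghomM : {morph f : x y / x ** y >-> x ** y}
}.

HB.structure Definition AlgHom (R : numDomainType) (A B : normedAlgType R) :=
  {f of @GRing.Linear R A B *:%R f & isAlgMultiplicative R A B f}.

Notation "{ 'alghom' A '->' B }" := (AlgHom.type A B) : type_scope.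

Section AmulTheory.
Context {R : numDomainType} {A : normedAlgType R}.
Implicit Types x y z : A.

Lemma amul0r x : 0 ** x = 0.
Proof. by have := amulZl 0 0 x; rewrite !scale0r. Qed.

Lemma amulr0 x : x ** 0 = 0.
Proof. by have := amulZr 0 x 0; rewrite !scale0r. Qed.

Lemma amulBl x y z : (x - y) ** z = x ** z - y ** z.
Proof. by rewrite amulDl -scaleN1r amulZl scaleN1r. Qed.

Lemma amulBr x y z : x ** (y - z) = x ** y - x ** z.
Proof. by rewrite amulDr -scaleN1r amulZr scaleN1r. Qed.

End AmulTheory.

Section C0.
Context {R : realType} {X : topologicalType}.

Definition vanishes_at_infinity (f : X -> R) :=
  forall e : R, 0 < e -> compact [set x | e <= `|f x|].

Definition C0_pred : {pred X -> R^o} :=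
  fun f => `[< continuous f /\ vanishes_at_infinity f >].

Lemma C0_predP (f : X -> R^o) :
  reflect (continuous f /\ vanishes_at_infinity f) (f \in C0_pred).
Proof. exact: asboolP. Qed.

(* the superlevel sets of a continuous function are closed, so compactness
   passes to smaller ones *)
Lemma vanishes_at_infinity_sub (f : X -> R) :
  continuous f ->
  (forall e : R, 0 < e ->
     exists2 K : set X, compact K & [set x | e <= `|f x|] `<=` K) ->
  vanishes_at_infinity f.
Proof.
move=> cf hf e e0; have [K cK sK] := hf e e0.
apply: (subclosed_compact _ cK sK).
have /continuous_closedP h : continuous (fun x => `|f x|).
  by move=> x; apply: cvg_norm; exact: cf.
exact: (h _ (@closed_ge R e)).
Qed.

Lemma C0_submod_closed : submod_closed C0_pred.
Proof.
split.
  apply/C0_predP; split; first exact: (@cst_continuous X R 0).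
  move=> e e0; rewrite (_ : [set x | _] = set0); first exact: compact0.
  by apply/seteqP; split => x //=; rewrite normr0 leNgt e0.
move=> a f g /C0_predP[cf vf] /C0_predP[cg vg]; apply/C0_predP.
have cafg : continuous (fun x => a * f x + g x : R).
  move=> x; apply: cvgD; last exact: cg.
  by apply: cvgM; [exact: cvg_cst|exact: cf].
split; first exact: cafg.
apply: (vanishes_at_infinity_sub cafg) => e e0.
have a1 : 0 < `|a| + 1 by rewrite ltr_wpDl.
have d0 : 0 < e / 2 / (`|a| + 1) by rewrite !divr_gt0.
have d1 : 0 < e / 2 by rewrite divr_gt0.
exists ([set x | e / 2 / (`|a| + 1) <= `|f x|] `|` [set x | e / 2 <= `|g x|]).
  by apply: compactU; [exact: vf|exact: vg].
move=> x /= he; apply: contrapT => /not_orP[/negP + /negP].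
rewrite -!ltNge => hf hg; move: he; rewrite leNgt => /negP; apply.
rewrite (le_lt_trans (ler_normD _ _))// [ltRHS]splitr ltr_leD//; last exact: ltW.
rewrite normrM; move: hf; rewrite ltr_pdivlMr// => hf.
rewrite (le_lt_trans _ hf)// mulrC ler_wpM2l//.
by rewrite lerDl.
Qed.

HB.instance Definition _ :=
  GRing.isSubmodClosed.Build R (X -> R^o) C0_pred C0_submod_closed.

End C0.

Record C0 (R : realType) (X : topologicalType) := MkC0 {
  C0_fun :> X -> R^o;
  _ : C0_fun \in @C0_pred R X
}.

HB.instance Definition _ R X := [isSub for @C0_fun R X].
HB.instance Definition _ R X := [Choice of C0 R X by <:].
HB.instance Definition _ R X := [SubChoice_isSubLmodule of C0 R X by <:].

Section C0_normed_algebra.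
Context {R : realType} {X : topologicalType}.
Implicit Types f g h : C0 R X.

Lemma C0_inj f g : (forall x, f x = g x) -> f = g.
Proof. by move=> fg; apply: val_inj; apply/funext. Qed.

Lemma C0_continuous f : continuous (f : X -> R).
Proof. by have /C0_predP[] := valP f. Qed.

Lemma C0_vanishes f : vanishes_at_infinity f.
Proof. by have /C0_predP[] := valP f. Qed.

Definition C0_norm f : R := sup (range (fun x => `|f x|)).

Lemma C0_bounded f : exists M : R, forall x, `|f x| <= M.
Proof.
have c1 := @C0_vanishes f 1 ltr01.
have cf : {within [set x | 1 <= `|f x|], continuous (f : X -> R)}.
  exact/continuous_subspaceT/C0_continuous.
have /compact_bounded[M [_ MA]] := continuous_compact cf c1.
exists (Num.max 1 (`|M| + 1)) => x; rewrite le_max.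
have [//|/ltW fx] := leP `|f x| 1; apply/orP; right.
by apply: MA; [rewrite (le_lt_trans (ler_norm _))// ltrDl|exists x].
Qed.

Lemma C0_norm_ub f x : `|f x| <= C0_norm f.
Proof.
have [M hM] := C0_bounded f.
by apply: ub_le_sup; [exists M => _ [y _ <-]|exists x].
Qed.

Lemma C0_norm_ge0 f : 0 <= C0_norm f.
Proof.
have [X0|/set0P[x _]] := eqVneq [set: X] set0.
  by rewrite /C0_norm X0 image_set0 sup0.
exact: le_trans (normr_ge0 (f x)) (C0_norm_ub f x).
Qed.

Lemma C0_norm_le f (M : R) :
  0 <= M -> (forall x, `|f x| <= M) -> C0_norm f <= M.
Proof.
move=> M0 fM; rewrite /C0_norm; set E := range (fun x => `|f x|).
have [->|A0] := eqVneq E set0; first by rewrite sup0.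
by apply: ge_sup; [exact/set0P/A0|move=> _ [x _ <-]; exact: fM].
Qed.

Lemma C0_norm_triangle f g : C0_norm (f + g) <= C0_norm f + C0_norm g.
Proof.
apply: C0_norm_le; first by rewrite addr_ge0// C0_norm_ge0.
by move=> x; rewrite (le_trans (ler_normD _ _))// lerD// C0_norm_ub.
Qed.

Lemma C0_normZ (k : R) f : C0_norm (k *: f) = `|k| * C0_norm f.
Proof.
have le k' g : C0_norm (k' *: g) <= `|k'| * C0_norm g.
  apply: C0_norm_le; first by rewrite mulr_ge0// C0_norm_ge0.
  by move=> x; rewrite [_ x]/(k' * g x) normrM ler_wpM2l// C0_norm_ub.
apply/eqP; rewrite eq_le le /=; have [->|k0] := eqVneq k 0.
  by rewrite normr0 mul0r C0_norm_ge0.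
rewrite -ler_pdivlMl ?normr_gt0// -normfV.
by rewrite (le_trans _ (le _ _))// scalerA mulVf// scale1r.
Qed.

Lemma C0_norm_eq0 f : C0_norm f = 0 -> f = 0.
Proof.
move=> f0; apply: C0_inj => x; apply/eqP.
by rewrite [X in _ == X](_ : _ = 0)// -normr_le0 -f0 C0_norm_ub.
Qed.

HB.instance Definition _ := @Lmodule_isNormed.Build R (C0 R X)
  C0_norm C0_norm_triangle C0_normZ C0_norm_eq0.

Lemma C0_mul_subproof f g : (fun x => f x * g x : R^o) \in @C0_pred R X.
Proof.
apply/C0_predP.
have cfg : continuous (fun x => f x * g x : R).
  by move=> x; apply: cvgM; exact: C0_continuous.
split; first exact: cfg.
apply: (vanishes_at_infinity_sub cfg) => e e0.
have g1 : 0 < C0_norm g + 1 by rewrite ltr_wpDl// C0_norm_ge0.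
exists [set x | e / (C0_norm g + 1) <= `|f x|].
  by apply: C0_vanishes; rewrite divr_gt0.
move=> x /=; rewrite normrM ler_pdivrMr// => /le_trans; apply.
by rewrite ler_wpM2l// (le_trans (C0_norm_ub g x))// lerDl.
Qed.

Definition C0_mul f g : C0 R X := MkC0 (C0_mul_subproof f g).

Lemma C0_mulA : associative C0_mul.
Proof. by move=> f g h; apply: C0_inj => x /=; rewrite mulrA. Qed.

Lemma C0_mulDl : left_distributive C0_mul +%R.
Proof. by move=> f g h; apply: C0_inj => x /=; exact: mulrDl. Qed.

Lemma C0_mulDr : right_distributive C0_mul +%R.
Proof. by move=> f g h; apply: C0_inj => x /=; exact: mulrDr. Qed.

Lemma C0_mulZl (k : R) f g : C0_mul (k *: f) g = k *: C0_mul f g.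
Proof. by apply: C0_inj => x /=; exact: esym (mulrA _ _ _). Qed.

Lemma C0_mulZr (k : R) f g : C0_mul f (k *: g) = k *: C0_mul f g.
Proof. by apply: C0_inj => x /=; exact: mulrCA. Qed.

Lemma C0_normM f g : `|C0_mul f g| <= `|f| * `|g|.
Proof.
apply: C0_norm_le; first by rewrite mulr_ge0// C0_norm_ge0.
by move=> x /=; rewrite normrM ler_pM// C0_norm_ub.
Qed.

HB.instance Definition _ := @NormedModule_isNormedAlgebra.Build R (C0 R X)
  C0_mul C0_mulA C0_mulDl C0_mulDr C0_mulZl C0_mulZr C0_normM.

End C0_normed_algebra.

Record closed_ideal (R : realType) (B : normedAlgType R) := ClosedIdeal {
  ideal_set :> B -> Prop;
  ideal0 : ideal_set 0;
  idealD : forall x y, ideal_set x -> ideal_set y -> ideal_set (x + y);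
  idealZ : forall (k : R) x, ideal_set x -> ideal_set (k *: x);
  idealMl : forall a x, ideal_set x -> ideal_set (a ** x);
  idealMr : forall a x, ideal_set x -> ideal_set (x ** a);
  ideal_closed : closed (ideal_set : set B)
}.

Section Quotient.
Context {R : realType} {B : normedAlgType R} (I : closed_ideal B).
Implicit Types x y z : B.

Lemma idealN x : I x -> I (- x).
Proof. by move=> Ix; rewrite -scaleN1r; exact: idealZ. Qed.

Lemma idealB x y : I x -> I y -> I (x - y).
Proof. by move=> Ix /idealN; exact: idealD. Qed.

Definition ideal_equiv x y : bool := `[< I (x - y) >].

Lemma ideal_equiv_is_equiv : equiv_class_of ideal_equiv.
Proof.
split=> [x|x y|y x z].
- by apply/asboolP; rewrite subrr; exact: ideal0.
- by apply/asboolP/asboolP => /idealN; rewrite opprB.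
- move=> /asboolP Ixy /asboolP Iyz; apply/asboolP.
  by have := idealD Ixy Iyz; rewrite addrA subrK.
Qed.

Canonical ideal_equiv_equiv := EquivRelPack ideal_equiv_is_equiv.
Canonical ideal_equiv_encModRel := defaultEncModRel ideal_equiv.

Definition quotAlg := {eq_quot ideal_equiv}.
HB.instance Definition _ := Choice.on quotAlg.
HB.instance Definition _ : EqQuotient B ideal_equiv quotAlg :=
  EqQuotient.on quotAlg.

Local Notation p := (\pi_quotAlg).

Lemma quot_eqP x y : p x = p y <-> I (x - y).
Proof.
by split=> [/eqquotP/asboolP|h]//; apply/eqquotP; exact/asboolP.
Qed.

Definition quot_zero : quotAlg := p 0.
Definition quot_opp (u : quotAlg) : quotAlg := p (- repr u).
Definition quot_add (u v : quotAlg) : quotAlg := p (repr u + repr v).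
Definition quot_scale (k : R) (u : quotAlg) : quotAlg := p (k *: repr u).
Definition quot_mul (u v : quotAlg) : quotAlg := p (repr u ** repr v).

Lemma reprB x : I (repr (p x) - x).
Proof. by apply/quot_eqP; rewrite reprK. Qed.

Lemma pi_oppE x : quot_opp (p x) = p (- x).
Proof. by apply/quot_eqP; rewrite -opprD; exact: idealN (reprB x). Qed.

Lemma pi_addE x y : quot_add (p x) (p y) = p (x + y).
Proof.
apply/quot_eqP; rewrite opprD addrACA.
by apply: idealD; exact: reprB.
Qed.

Lemma pi_scaleE k x : quot_scale k (p x) = p (k *: x).
Proof. by apply/quot_eqP; rewrite -scalerBr; exact: idealZ (reprB x). Qed.

Lemma pi_mulE x y : quot_mul (p x) (p y) = p (x ** y).
Proof.
apply/quot_eqP; set x' := repr _; set y' := repr _.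
rewrite (_ : _ - _ = x' ** (y' - y) + (x' - x) ** y).
  by apply: idealD; [apply: idealMl|apply: idealMr]; exact: reprB.
by rewrite amulBr amulBl addrA subrK.
Qed.

Lemma quot_ind (P : quotAlg -> Prop) : (forall x, P (p x)) -> forall u, P u.
Proof. by move=> Pp u; rewrite -[u]reprK. Qed.

Lemma quot_addA : associative quot_add.
Proof.
elim/quot_ind=> x; elim/quot_ind=> y; elim/quot_ind=> z.
by rewrite !pi_addE addrA.
Qed.

Lemma quot_addC : commutative quot_add.
Proof. by elim/quot_ind=> x; elim/quot_ind=> y; rewrite !pi_addE addrC. Qed.

Lemma quot_add0 : left_id quot_zero quot_add.
Proof. by elim/quot_ind=> x; rewrite pi_addE add0r. Qed.

Lemma quot_addN : left_inverse quot_zero quot_opp quot_add.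
Proof. by elim/quot_ind=> x; rewrite pi_oppE pi_addE addNr. Qed.

HB.instance Definition _ :=
  GRing.isZmodule.Build quotAlg quot_addA quot_addC quot_add0 quot_addN.

Lemma piD x y : p (x + y) = p x + p y.
Proof. by rewrite -pi_addE. Qed.

Lemma quot_scaleA a b u : quot_scale a (quot_scale b u) = quot_scale (a * b) u.
Proof. by elim/quot_ind: u => x; rewrite !pi_scaleE scalerA. Qed.

Lemma quot_scale1 : left_id 1 quot_scale.
Proof. by elim/quot_ind=> x; rewrite pi_scaleE scale1r. Qed.

Lemma quot_scaleDr : right_distributive quot_scale +%R.
Proof.
move=> k; elim/quot_ind=> x; elim/quot_ind=> y.
by rewrite -piD !pi_scaleE -piD scalerDr.
Qed.

Lemma quot_scaleDl u : {morph quot_scale^~ u : a b / a + b}.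
Proof. by move=> a b; elim/quot_ind: u => x; rewrite !pi_scaleE -piD scalerDl. Qed.

HB.instance Definition _ := GRing.Zmodule_isLmodule.Build R quotAlg
  quot_scaleA quot_scale1 quot_scaleDr quot_scaleDl.

Lemma piZ k x : p (k *: x) = k *: p x.
Proof. by rewrite -pi_scaleE. Qed.

Definition quot_norm (u : quotAlg) : R := inf [set `|x| | x in [set x | p x = u]].

Lemma quot_norm_has_inf u : has_inf [set `|x| | x in [set x | p x = u]].
Proof.
split; first by exists `|repr u|, (repr u) => //=; exact: reprK.
by exists 0 => _ [x _ <-].
Qed.

Lemma quot_norm_pi_le x : quot_norm (p x) <= `|x|.
Proof. by apply: ge_inf; [case: (quot_norm_has_inf (p x))|exists x]. Qed.

Lemma quot_norm_ge0 u : 0 <= quot_norm u.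
Proof.
by apply: lb_le_inf; [case: (quot_norm_has_inf u)|move=> _ [x _ <-]].
Qed.

Lemma quot_norm_approx u (e : R) : 0 < e ->
  exists2 x, p x = u & `|x| < quot_norm u + e.
Proof.
move=> e0; have [_ [x xu <-] xe] := inf_adherent e0 (quot_norm_has_inf u).
by exists x.
Qed.

Lemma quot_norm_triangle u v : quot_norm (u + v) <= quot_norm u + quot_norm v.
Proof.
apply/ler_addgt0Pr => e e0.
have e2 : 0 < e / 2 by rewrite divr_gt0.
have [x <- xe] := quot_norm_approx u e2.
have [y <- ye] := quot_norm_approx v e2.
rewrite -piD (le_trans (quot_norm_pi_le _))// (le_trans (ler_normD _ _))//.
by rewrite [e in leRHS]splitr addrACA lerD// ltW.
Qed.

Lemma quot_normZ k u : quot_norm (k *: u) = `|k| * quot_norm u.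
Proof.
have le k' v : quot_norm (k' *: v) <= `|k'| * quot_norm v.
  apply/ler_addgt0Pr => e e0.
  have k1 : 0 < `|k'| + 1 by rewrite ltr_wpDl.
  have [x <- xe] := quot_norm_approx v (divr_gt0 e0 k1).
  rewrite -piZ (le_trans (quot_norm_pi_le _))// normrZ.
  rewrite (le_trans (ler_wpM2l _ (ltW xe)))// mulrDr lerD2l.
  by rewrite mulrCA ler_piMr ?ltW// ltr_pdivrMr// mul1r ltrDl.
apply/eqP; rewrite eq_le le /=; have [->|k0] := eqVneq k 0.
  by rewrite normr0 mul0r quot_norm_ge0.
rewrite -ler_pdivlMl ?normr_gt0// -normfV.
by rewrite (le_trans _ (le _ _))// scalerA mulVf// scale1r.
Qed.

(* uses that the ideal is closed *)
Lemma quot_norm_eq0 u : quot_norm u = 0 -> u = 0.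
Proof.
elim/quot_ind: u => x px0; apply/quot_eqP; rewrite subr0.
apply: ideal_closed => U /nbhs_ballP[e /= e0 eU].
have [y yx ye] := quot_norm_approx (p x) e0.
exists (x - y); split; first by apply/quot_eqP.
apply: eU; rewrite -ball_normE /= opprB addrC subrK.
by move: ye; rewrite px0 add0r.
Qed.

HB.instance Definition _ := @Lmodule_isNormed.Build R quotAlg
  quot_norm quot_norm_triangle quot_normZ quot_norm_eq0.

Lemma quot_mulA : associative quot_mul.
Proof.
elim/quot_ind=> x; elim/quot_ind=> y; elim/quot_ind=> z.
by rewrite !pi_mulE amulA.
Qed.

Lemma quot_mulDl : left_distributive quot_mul +%R.
Proof.
elim/quot_ind=> x; elim/quot_ind=> y; elim/quot_ind=> z.
by rewrite -piD !pi_mulE -piD amulDl.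
Qed.

Lemma quot_mulDr : right_distributive quot_mul +%R.
Proof.
elim/quot_ind=> x; elim/quot_ind=> y; elim/quot_ind=> z.
by rewrite -piD !pi_mulE -piD amulDr.
Qed.

Lemma quot_mulZl (k : R) u v : quot_mul (k *: u) v = k *: quot_mul u v.
Proof.
elim/quot_ind: u => x; elim/quot_ind: v => y.
by rewrite -piZ !pi_mulE -piZ amulZl.
Qed.

Lemma quot_mulZr (k : R) u v : quot_mul u (k *: v) = k *: quot_mul u v.
Proof.
elim/quot_ind: u => x; elim/quot_ind: v => y.
by rewrite -piZ !pi_mulE -piZ amulZr.
Qed.

Lemma quot_normM u v : `|quot_mul u v| <= `|u| * `|v|.
Proof.
have h x y : quot_norm (p (x ** y)) <= `|x| * `|y|.
  by rewrite (le_trans (quot_norm_pi_le _))// normr_amul.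
have step x : quot_norm (quot_mul (p x) v) <= `|x| * quot_norm v.
  apply/ler_addgt0Pr => e e0.
  have k1 : 0 < `|x| + 1 by rewrite ltr_wpDl.
  have [y <- ye] := quot_norm_approx v (divr_gt0 e0 k1).
  rewrite pi_mulE (le_trans (h _ _))//.
  rewrite (le_trans (ler_wpM2l _ (ltW ye)))// mulrDr lerD2l.
  by rewrite mulrCA ler_piMr ?ltW// ltr_pdivrMr// mul1r ltrDl.
change (quot_norm (quot_mul u v) <= quot_norm u * quot_norm v).
apply/ler_addgt0Pr => e e0.
have k1 : 0 < quot_norm v + 1 by rewrite ltr_wpDl// quot_norm_ge0.
have [x xu xe] := quot_norm_approx u (divr_gt0 e0 k1).
rewrite -{1}xu (le_trans (step _))//.
rewrite (le_trans (ler_wpM2r _ (ltW xe))) ?quot_norm_ge0// mulrDl lerD2l.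
by rewrite mulrAC -mulrA ler_piMr ?ltW// ltr_pdivrMr// mul1r ltrDl.
Qed.

HB.instance Definition _ := @NormedModule_isNormedAlgebra.Build R quotAlg
  quot_mul quot_mulA quot_mulDl quot_mulDr quot_mulZl quot_mulZr quot_normM.

Definition quot_map (x : B) : quotAlg := p x.

Lemma quot_map_linear : linear quot_map.
Proof. by move=> k x y; rewrite /quot_map piD piZ. Qed.

Lemma quot_map_mul : {morph quot_map : x y / x ** y >-> x ** y}.
Proof. by move=> x y; rewrite /quot_map -pi_mulE. Qed.

HB.instance Definition _ :=
  GRing.isLinear.Build R B quotAlg *:%R quot_map quot_map_linear.
HB.instance Definition _ :=
  isAlgMultiplicative.Build R B quotAlg quot_map quot_map_mul.

End Quotient.

Section Kernel.
Context {R : realType} {A B : normedAlgType R}.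
Variables (f : {alghom B -> A}) (cf : continuous f).

Let ker := [set x | f x = 0].

Fact ker0 : ker 0. Proof. by rewrite /ker/= linear0. Qed.

Fact kerD x y : ker x -> ker y -> ker (x + y).
Proof. by rewrite /ker/= linearD/= => -> ->; rewrite addr0. Qed.

Fact kerZ (k : R) x : ker x -> ker (k *: x).
Proof. by rewrite /ker/= linearZ/= => ->; rewrite scaler0. Qed.

Fact kerMl a x : ker x -> ker (a ** x).
Proof. by rewrite /ker/= alghomM => ->; rewrite amulr0. Qed.

Fact kerMr a x : ker x -> ker (x ** a).
Proof. by rewrite /ker/= alghomM => ->; rewrite amul0r. Qed.

Fact ker_closed : closed ker.
Proof.
have /continuous_closedP h := cf; apply: (h [set 0]).
exact/accessible_closed_set1/hausdorff_accessible/norm_hausdorff.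
Qed.

Definition Ker : closed_ideal B :=
  ClosedIdeal ker0 kerD kerZ kerMl kerMr ker_closed.

Lemma Ker_factor_exists :
  exists g : {alghom quotAlg Ker -> A}, forall x, f x = g (quot_map Ker x).
Proof.
pose g (u : quotAlg Ker) : A := f (repr u).
have gE x : g (quot_map Ker x) = f x.
  apply/eqP; rewrite -subr_eq0 -linearB; apply/eqP.
  exact: (reprB Ker x).
have uE (u : quotAlg Ker) : u = quot_map Ker (repr u) by rewrite /quot_map reprK.
have gl : linear g.
  by move=> k u v; rewrite (uE u) (uE v) -linearP !gE linearP.
have gm : {morph g : x y / x ** y >-> x ** y}.
  by move=> u v; rewrite (uE u) (uE v) -alghomM !gE alghomM.
pose gL := GRing.isLinear.Build R (quotAlg Ker) A *:%R g gl.
pose gM := isAlgMultiplicative.Build R (quotAlg Ker) A g gm.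
pose gH : {alghom quotAlg Ker -> A} := HB.pack g gL gM.
by exists gH => x; rewrite /= gE.
Qed.

End Kernel.

(* sup is meaningful only for a bounded set, i.e. for f bounded on the unit
   ball, as a continuous linear map is *)
Definition opnorm (R : realType) (V W : normedModType R) (f : V -> W) : R :=
  sup [set `|f x| | x in [set x | `|x| <= 1]].

Definition subalgebra (R : realType) (A : normedAlgType R) (S : set A) : Prop :=
  [/\ S 0, forall x y, S x -> S y -> S (x + y),
      forall (k : R) x, S x -> S (k *: x) &
      forall x y, S x -> S y -> S (x ** y)].

(* a homeomorphism onto its range, the latter with the subspace topology *)
Definition topological_embedding (S T : topologicalType) (f : S -> T) : Prop :=
  [/\ injective f, continuous f &
      forall U : set S, open U ->
        exists2 V : set T, open V & f @` U = V `&` range f].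

(* Main.v *)
(** The key point is the lower bound. Given [c > `|pi f|], let [k] be [f]
    truncated to values in [-c, c]. The function [g = f - k] vanishes where
    [`|f| < c], so it can be divided by any power of [f]: [g = f^(2n) h_n]
    with [`|h_n| <= c^(-2n) `|g|]. Hence
    [`|pi g| <= (`|pi f| / c)^(2n) `|pi| `|g|], which tends to [0], so [g] is in
    the kernel and [`|q f| <= `|f - g| = `|k| <= c]. Closedness of the range
    follows from the completeness of [C0], since elements of the range lift to
    elements of almost the same norm. *)
Require Import Defs.
From HB Require Import structures.
From mathcomp Require Import all_boot all_order all_algebra.
From mathcomp Require Import all_classical all_reals all_analysis.
From mathcomp Require Import lra.

Set Implicit Arguments.
Unset Strict Implicit.
Unset Printing Implicit Defensive.

Import Order.TTheory GRing.Theory Num.Theory.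
Import numFieldNormedType.Exports.

Local Open Scope classical_set_scope.
Local Open Scope ring_scope.

(** * Continuous linear maps: operator norm, embeddings, closed ranges *)

Section NormedModules.
Context {R : realType}.

Lemma opnorm_ub (V W : normedModType R) (f : {linear V -> W}) (x : V) :
  continuous f -> `|x| <= 1 -> `|f x| <= opnorm f.
Proof.
move=> /linear_bounded_continuous/linear_boundedP/pinfty_ex_gt0[M M0 fM] x1.
apply: ub_le_sup; last by exists x.
exists M => _ [y /= y1 <-]; rewrite (le_trans (fM _))//.
by rewrite ler_piMr// ltW.
Qed.

Lemma opnorm_ge0 (V W : normedModType R) (f : {linear V -> W}) :
  continuous f -> 0 <= opnorm f.
Proof.
move=> cf; have := @opnorm_ub _ _ f 0 cf.
by rewrite linear0 !normr0; apply; exact: ler01.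
Qed.

Lemma ler_opnorm (V W : normedModType R) (f : {linear V -> W}) (x : V) :
  continuous f -> `|f x| <= opnorm f * `|x|.
Proof.
move=> cf; have [->|x0] := eqVneq x 0; first by rewrite linear0 !normr0 mulr0.
have nx0 : 0 < `|x| by rewrite normr_gt0.
have <- : `|f (`|x|^-1 *: x)| * `|x| = `|f x|.
  by rewrite linearZ normrZ ger0_norm ?invr_ge0// mulrAC mulVf ?mul1r// gt_eqF.
rewrite ler_wpM2r//; apply: opnorm_ub => //.
by rewrite normrZ ger0_norm ?invr_ge0// mulVf ?gt_eqF.
Qed.

(** The lower bound makes the kernel trivial and the inverse 1-Lipschitz on the range, so radii of
    balls carry over unchanged. *)
Lemma topological_embedding_linear (V W : normedModType R)
    (f : {linear V -> W}) :
  continuous f -> (forall x, `|x| <= `|f x|) -> topological_embedding f.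
Proof.
move=> cf fge; have finj : injective f.
  move=> x y fxy; apply/eqP; rewrite -subr_eq0 -normr_le0.
  by rewrite (le_trans (fge _))// linearB fxy subrr normr0.
split=> // U oU.
(* Around each [f x] goes a ball whose radius [e] already fits around [x] inside [U]; a point [f y]
   of the range in it has [y] within [e] of [x]. *)
exists (\bigcup_(p in [set p : V * R | 0 < p.2 /\ ball p.1 p.2 `<=` U])
          ball (f p.1) p.2).
  by apply: bigcup_open => -[x e] /= [e0 _]; exact: ball_open.
apply/seteqP; split=> [_ [x Ux <-]|z [[[x e] /= [_ xeU] xey] [y _ fy]]].
  split; last by exists x.
  have /nbhs_ballP[e /= e0 xeU] := open_nbhs_nbhs (conj oU Ux).
  by exists (x, e) => //; exact: ballxx.
exists y => //; apply: xeU; move: xey; rewrite -fy -!ball_normE /= -linearB.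
exact: le_lt_trans (fge _).
Qed.

(** Preimages of approximations to [a] need not converge, as [f] may have a kernel. Their successive
    differences are therefore replaced by lifts of controlled norm, whose series converges in
    [V]. *)
Lemma closed_range_linear (V : completeNormedModType R) (W : normedModType R)
    (f : {linear V -> W}) :
  continuous f ->
  (forall x (e : R), 0 < e -> exists2 y, f y = f x & `|y| <= `|f x| + e) ->
  closed (range f).
Proof.
move=> cf lift a cl_a.
have half0 n : 0 < (2^-1 : R) ^+ n by rewrite exprn_gt0// invr_gt0.
have /choice[g gP] n : exists x, `|a - f x| < 2^-1 ^+ n.
  have [_ [[x _ <-]]] := cl_a _ (nbhsx_ballx a _ (half0 n)).
  by rewrite -ball_normE; exists x.
(* In the constant 3, [f (g n.+1)] and [f (g n)] are at most [2 * 2^-n] apart through [a], and the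
   slack of the lift adds [2^-n]. *)
have /choice[d dP] n :
    exists y, f y = f (g n.+1 - g n) /\ `|y| <= 3 * 2^-1 ^+ n.
  have [y fy yle] := lift (g n.+1 - g n) _ (half0 n).
  exists y; split=> //; rewrite (le_trans yle)//.
  rewrite -[3]/((2 + 1)%:R : R) natrD mulrDl mul1r lerD2r linearB.
  rewrite (le_trans (ler_distD a _ _))// distrC mulr_natl mulr2n.
  rewrite lerD ?(ltW (gP n))// (le_trans (ltW (gP _)))//.
  by rewrite exprS ler_piMl ?(ltW (half0 n))// ltW// invf_lt1// ltr1n.
have cvg_d : cvgn (series d).
  apply: normed_cvg; apply: (@series_le_cvg _ _ (geometric 3 2^-1)) => [n|n|n|].
  - exact: normr_ge0.
  - by rewrite /= mulr_ge0// ltW.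
  - by have [] := dP n.
  - apply: is_cvg_geometric_series.
    by rewrite ger0_norm ?invr_ge0// invf_lt1// ltr1n.
set l := limn (series d) in cvg_d.
exists (l + g 0) => //.
(* The images telescope to [f (g n) - f (g 0)], hence the shift by [g 0]. *)
have fsE n : f (series d n + g 0) = f (g n).
  rewrite linearD /series/= linear_sum.
  rewrite (eq_bigr (fun k => f (g k.+1) - f (g k))).
    by rewrite (telescope_sumr (f \o g))//= subrK.
  by move=> k _; rewrite (dP k).1 linearB.
have cvg_fg : f (g n) @[n --> \oo] --> f (l + g 0).
  rewrite -(funext fsE : (fun n => f (series d n + g 0)) = fun n => f (g n)).
  apply: continuous_cvg; first exact: cf.
  by apply: cvgD => //; exact: cvg_cst.
apply: (cvg_unique _ cvg_fg); first exact: norm_hausdorff.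
apply/cvgrPdist_lt => e e0.
have : geometric 1 (2^-1 : R) n @[n --> \oo] --> (0 : R).
  by apply: cvg_geometric; rewrite ger0_norm ?invr_ge0// invf_lt1// ltr1n.
move=> /cvgr_dist_lt/(_ e e0); apply: filterS => n /=.
rewrite sub0r normrN mul1r ger0_norm ?ltW//.
exact: lt_trans.
Qed.

End NormedModules.

(** * The space [C0 R X]: membership, completeness, division, truncation *)

Section C0.
Context {R : realType} {X : topologicalType}.
Implicit Types f g h : C0 R X.

(** The points with [e <= |u x|] lie in the compact set where [e / a <= |f x|]. *)
Lemma C0_dominated (u : X -> R) f (a : R) :
  continuous u -> 0 < a -> (forall x, `|u x| <= a * `|f x|) ->
  u \in @C0_pred R X.
Proof.
move=> cu a0 ule; apply/C0_predP; split=> //.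
apply: vanishes_at_infinity_sub => // e e0.
exists [set x | e / a <= `|f x|]; first by apply: C0_vanishes; rewrite divr_gt0.
by move=> x /= eu; rewrite ler_pdivrMr// mulrC (le_trans eu).
Qed.

(** Continuity is the three-term estimate through [f x] and [f y]. For vanishing, an [f] within
    [e / 2] of [u] satisfies [e / 2 <= |f x|] wherever [e <= |u x|]. *)
Lemma C0_uniform_closed (u : X -> R) :
  (forall e : R, 0 < e -> exists f, forall x, `|f x - u x| <= e) ->
  u \in @C0_pred R X.
Proof.
move=> uP; have cu : continuous u.
  move=> x; apply/cvgrPdist_lt => e e0.
  have e3 : 0 < e / 3 by rewrite divr_gt0.
  have [f fu] := uP _ e3.
  have /cvgr_dist_lt/(_ _ e3) := @C0_continuous R X f x.
  apply: filterS => y fxy.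
  have := fu x; have := fu y; have := ler_distD (f x) (u x) (u y).
  have := ler_distD (f y) (f x) (u y); rewrite [`|u x - f x|]distrC.
  by move: fxy; lra.
apply/C0_predP; split=> //; apply: vanishes_at_infinity_sub => // e e0.
have e2 : 0 < e / 2 by rewrite divr_gt0.
have [f fu] := uP _ e2.
exists [set x | e / 2 <= `|f x|]; first exact: C0_vanishes.
move=> x /= eu; rewrite -(lerD2r (e / 2)) -splitr (le_trans eu)//.
rewrite -{1}[u x](subrK (f x)) (le_trans (ler_normD _ _))//.
by rewrite addrC lerD2l distrC.
Qed.

(** Completeness of the reals gives a pointwise limit [u]; the Cauchy estimates are uniform in [x]
    and pass to it. *)
Lemma C0_cauchy_cvg (F : set_system (C0 R X)) :
  ProperFilter F -> cauchy F -> cvg F.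
Proof.
move=> PF /cauchyP Fc.
have near_F (e : R) : 0 < e -> exists f, \forall g \near F, `|f - g| <= e.
  move=> /Fc[f Ff]; exists f; near=> g; rewrite ltW//.
  by near: g; move: Ff; rewrite -ball_normE.
have le_pt f g x : `|f x - g x| <= `|f - g| by exact: (C0_norm_ub (f - g)).
have evc x : cvg ((fun g => g x : R) @ F).
  apply/cauchy_cvgP/cauchyP => e e0.
  have [f Ff] := near_F _ (divr_gt0 e0 (ltr0n R 2)).
  exists (f x); apply: (filterS _ Ff) => g fg; rewrite /= -ball_normE /=.
  apply: (le_lt_trans (le_pt f g x)); apply: (le_lt_trans fg).
  by rewrite ltr_pdivrMr// ltr_pMr// ltr1n.
pose u x : R := lim ((fun g => g x : R) @ F).
have uP f (e : R) : (\forall g \near F, `|f - g| <= e) ->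
    forall x, `|f x - u x| <= e.
  move=> Ff x; apply: (@cvgr_to_le _ F _ _ (fun g => `|f x - g x|)).
    by apply: cvg_norm; apply: cvgB; [exact: cvg_cst|exact: evc].
  by apply: filterS Ff => g; exact: le_trans.
have uC0 : u \in @C0_pred R X.
  apply: C0_uniform_closed => e /near_F[f Ff].
  by exists f; exact: uP.
apply/cvg_ex; exists (MkC0 uC0); apply/cvgrPdist_lt => e e0.
have e3 : 0 < e / 3 by rewrite divr_gt0.
have [f Ff] := near_F _ e3.
have fu : `|f - MkC0 uC0| <= e / 3 by apply: C0_norm_le; [exact: ltW|exact: uP].
apply: filterS Ff => g fg.
rewrite (le_lt_trans (ler_distD f _ _))// distrC.
by move: fu fg; lra.
Unshelve. all: by end_near. Qed.

HB.instance Definition _ := Uniform_isComplete.Build (C0 R X) C0_cauchy_cvg.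

(** The quotient [h] is [g / max(f^2, c^2)]: the denominator is continuous, at least [c^2], and
    equal to [f^2] wherever [g] is nonzero. The last conclusion hands the hypothesis on [g] over to
    [h], so that division can be repeated. *)
Lemma C0_divide f g (c : R) :
  0 < c -> (forall x, g x != 0 -> c <= `|f x|) ->
  exists h, [/\ g = f ** f ** h, `|h| <= c ^- 2 * `|g| &
                forall x, h x != 0 -> c <= `|f x|].
Proof.
move=> c0 gf.
pose m x : R := Num.max (f x * f x) (c ^+ 2).
have c2 : 0 < c ^+ 2 by rewrite exprn_gt0.
have m0 x : 0 < m x by rewrite lt_max c2 orbT.
pose w x : R := (m x)^-1 * g x.
have wle x : `|w x| <= c ^- 2 * `|g x|.
  rewrite normrM ler_wpM2r// ger0_norm ?invr_ge0 ?(ltW (m0 x))//.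
  by rewrite lef_pV2 ?posrE// le_max lexx orbT.
have cw : continuous w.
  move=> x; apply: cvgM; last exact: C0_continuous.
  apply: cvgV; first by rewrite gt_eqF.
  apply: (@continuous_max R X (fun x => f x * f x) (cst (c ^+ 2))).
    by apply: cvgM; exact: C0_continuous.
  exact: cvg_cst.
have wC0 : w \in @C0_pred R X.
  by apply: (C0_dominated cw _ wle); rewrite invr_gt0.
exists (MkC0 wC0); split.
- apply: C0_inj => x; transitivity (f x * f x * w x : R); last by [].
  rewrite /w.
  have [gx0|/gf cf] := eqVneq (g x) 0; first by rewrite !gx0 !mulr0.
  have cff : c ^+ 2 <= f x * f x.
    rewrite -[leRHS]ger0_norm; last by rewrite -expr2 sqr_ge0.
    by rewrite normrM expr2 ler_pM// ltW.
  rewrite mulrA (_ : m x = f x * f x); last exact/max_idPl/cff.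
  by rewrite mulfV ?mul1r// gt_eqF// (lt_le_trans c2).
- apply: C0_norm_le => [|x]; first by rewrite mulr_ge0// invr_ge0 ltW.
  rewrite (le_trans (wle x))// ler_wpM2l ?invr_ge0 ?(ltW c2)//.
  exact: C0_norm_ub.
- move=> x; rewrite /= /w mulf_eq0 negb_or => /andP[_]; exact: gf.
Qed.

Lemma C0_truncate f (c : R) : 0 < c ->
  exists2 k, `|k| <= c & forall x, (f - k) x != 0 -> c <= `|f x|.
Proof.
move=> c0; pose u x : R := Num.max (- c) (Num.min c (f x)).
have cu : continuous u.
  move=> x; apply: (@continuous_max R X (cst (- c)) (fun x => Num.min c (f x))).
    exact: cvg_cst.
  apply: (@continuous_min R X (cst c) f); first exact: cvg_cst.
  exact: C0_continuous.
have uE x : `|f x| <= c -> u x = f x.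
  rewrite ler_norml => /andP[cf fc]; rewrite /u.
  by rewrite (min_idPr fc); exact/max_idPr.
have ule x : `|u x| <= c.
  rewrite ler_norml le_max lexx/= ge_max ge_min lexx/= andbT.
  by rewrite (@le_trans _ _ 0) ?oppr_le0 ?ltW.
have uC0 : u \in @C0_pred R X.
  (* Clamping to [[-c, c]] never increases the absolute value, so [f] itself dominates [u]. *)
  apply: (@C0_dominated _ f 1) => // x; rewrite mul1r.
  have [/uE ->//|/ltW] := leP `|f x| c.
  exact: le_trans.
exists (MkC0 uC0); first by apply: C0_norm_le; [exact: ltW|exact: ule].
move=> x; apply: contraR; rewrite -ltNge => /ltW/uE ux.
by change (f x - u x == 0 :> R); rewrite ux subrr.
Qed.

(** * The lower bound for a continuous homomorphism *)

Context {A : normedAlgType R}.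
Variables (pi : {alghom C0 R X -> A}) (pi_cont : continuous pi).

Lemma alghom_eq0 f g (c : R) :
  `|pi f| < c -> (forall x, g x != 0 -> c <= `|f x|) -> pi g = 0.
Proof.
move=> fc gf.
have c0 : 0 < c by rewrite (le_lt_trans _ fc).
pose r : R := c ^- 2 * `|pi f| ^+ 2.
have r0 : 0 <= r by rewrite mulr_ge0 ?invr_ge0 ?exprn_ge0// ltW.
have r1 : r < 1.
  by rewrite /r mulrC ltr_pdivrMr ?exprn_gt0// mul1r ltrXn2r ?nnegrE// ltW.
pose K := opnorm pi.
have K0 : 0 <= K by exact: opnorm_ge0.
have piK h : `|pi h| <= K * `|h| by exact: ler_opnorm.
have le_r n : `|pi g| <= geometric (K * `|g|) r n.
  (* The induction runs over all [g], since it is applied to the quotient [h]. The factor [c^-2]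
     from [|h|] and [|pi f|^2] from [f ** f] together give one more [r]. *)
  elim: n g gf => [|n IHn] g gf /=; first by rewrite expr0 mulr1.
  have [h [gE hg hf]] := C0_divide c0 gf.
  rewrite {1}gE !alghomM (le_trans (normr_amul _ _))//.
  rewrite (le_trans (ler_pM _ _ (normr_amul _ _) (IHn _ hf)))//= -expr2.
  rewrite [leLHS]mulrC mulrAC [r ^+ n.+1]exprS [leRHS]mulrA.
  rewrite ler_wpM2r ?exprn_ge0// -!mulrA ler_wpM2l// [leRHS]mulrA.
  by rewrite ler_wpM2r ?exprn_ge0// mulrC.
apply/eqP; rewrite -normr_le0.
have /cvgr_to_ge : geometric (K * `|g|) r n @[n --> \oo] --> (0 : R).
  by apply: cvg_geometric; rewrite ger0_norm.
by apply; exact: nearW.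
Qed.

Lemma quot_norm_le_alghom f : `|quot_map (Ker pi_cont) f| <= `|pi f|.
Proof.
apply/ler_addgt0Pr => e e0.
(* The slack [e] gives the strict inequality that [alghom_eq0] asks for, and a positive truncation
   level even if [pi f] is zero. *)
have fc : `|pi f| < `|pi f| + e by rewrite ltrDl.
have [k kc fk] := C0_truncate f (le_lt_trans (normr_ge0 _) fc).
have -> : quot_map (Ker pi_cont) f = quot_map (Ker pi_cont) k.
  apply/quot_eqP; exact: (alghom_eq0 fc fk).
exact: le_trans (quot_norm_pi_le _ _) kc.
Qed.

End C0.

Theorem proposition2p31 (R : realType) (X : topologicalType)
    (X_hausdorff : hausdorff_space X) (X_lc : locally_compact [set: X])
    (A : normedAlgType R)
    (pi : {alghom C0 R X -> A}) (pi_cont : continuous pi)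
    (pibar : {alghom quotAlg (Ker pi_cont) -> A})
    (pi_factor : forall f : C0 R X, pi f = pibar (quot_map (Ker pi_cont) f)) :
  let q := quot_map (Ker pi_cont) in
  (forall f : C0 R X,
     `|q f| <= `|pibar (q f)| /\ `|pibar (q f)| <= opnorm pi * `|q f|) /\
  [/\ topological_embedding pibar,
      range pibar = range pi,
      subalgebra (range pi) &
      closed (range pi)].
Proof.
move=> q.
have lower f : `|q f| <= `|pibar (q f)|.
  by rewrite -pi_factor; exact: quot_norm_le_alghom.
have op0 : 0 <= opnorm pi by exact: opnorm_ge0.
have upper f : `|pibar (q f)| <= opnorm pi * `|q f|.
  (* The added 1 permits division when [opnorm pi] is zero. A representative of norm below
     [|q f| + e / (opnorm pi + 1)] then costs at most [e] under [pi]. *)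
  have op1 : 0 < opnorm pi + 1 by rewrite ltr_wpDl.
  apply/ler_addgt0Pr => e e0.
  have [g gf ge] := quot_norm_approx (q f) (divr_gt0 e0 op1).
  have -> : pibar (q f) = pi g by rewrite pi_factor /quot_map gf.
  rewrite (le_trans (ler_opnorm _ pi_cont))//.
  rewrite (le_trans (ler_wpM2l op0 (ltW ge)))// mulrDr lerD2l.
  by rewrite mulrCA ler_piMr ?ltW// ltr_pdivrMr// mul1r ltrDl.
split=> [f|]; first by [].
split.
- apply: topological_embedding_linear; last exact: quot_ind.
  apply/linear_bounded_continuous/linear_boundedP.
  apply: (filterS _ (nbhs_pinfty_ge (num_real (opnorm pi)))) => r ler.
  by apply: quot_ind => f; rewrite (le_trans (upper f))// ler_wpM2r.
- apply/seteqP; split=> [_ [u _ <-]|_ [f _ <-]].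
    by move: u; apply: quot_ind => f; exists f => //; exact: pi_factor.
  by exists (q f).
- split.
  + by exists 0 => //; exact: linear0.
  + by move=> _ _ [f _ <-] [g _ <-]; exists (f + g) => //; exact: linearD.
  + by move=> k _ [f _ <-]; exists (k *: f) => //; exact: linearZ.
  + by move=> _ _ [f _ <-] [g _ <-]; exists (f ** g) => //; exact: alghomM.
(* This is applied to [pi], whose domain [C0 R X] is complete. The required lifts are nearly minimal
   representatives of [q f], and [|q f|] is at most [|pi f|]. *)
- apply: closed_range_linear => // f e e0.
  have [g gf ge] := quot_norm_approx (q f) e0.
  exists g.
    exact: etrans (pi_factor g) (etrans (congr1 pibar gf) (esym (pi_factor f))).
  exact: le_trans (ltW ge) (lerD (quot_norm_le_alghom pi_cont f) (lexx e)).
Qed.
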